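(* For every positive integer $M$ there exist a connected graph $G$ and a vertex $v\in V(G)$ that is not a cut vertex of $G$ such that $|\chi_d^t(G)-\chi_d^t(G-v)|\geq M$; that is, $|\chi_d^t(G)-\chi_d^t(G-v)|$ can be arbitrarily large.
   Context: All graphs are simple and finite. For a graph with no isolated vertex, a total dominator coloring (TD-coloring) is a proper vertex coloring in which every vertex is adjacent to every vertex of some color class (a class other than its own); $\chi_d^t$ denotes the minimum number of colors in such a coloring. $G-v$ is the graph obtained from $G$ by deleting $v$ and all edges incident to $v$. *)

(* Defs.v *)
From mathcomp Require Import all_boot.

Set Implicit Arguments.
Unset Strict Implicit.
Unset Printing Implicit Defensive.

Record sgraph := SGraph {
  vertex :> finType;
  adj : rel vertex;
  adj_sym : symmetric adj;
  adj_irr : irreflexive adj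
}.

Section Deletion.
Variables (G : sgraph) (v : G).

Definition del_adj : rel {x : G | x != v} := fun x y => adj (val x) (val y).

Fact del_adj_sym : symmetric del_adj.
Proof. by move=> x y; apply: adj_sym. Qed.

Fact del_adj_irr : irreflexive del_adj.
Proof. by move=> x; apply: adj_irr. Qed.

Definition del_vertex : sgraph := SGraph del_adj_sym del_adj_irr.

End Deletion.

Section Invariants.
Variable G : sgraph.

Definition connected_graph : bool :=
  (0 < #|G|) && [forall x : G, forall y : G, connect (@adj G) x y].

Definition num_components : nat := n_comp (@adj G) G.

Definition no_isolated : bool := [forall x : G, exists y : G, adj x y].

Definition proper_coloring (k : nat) (f : {ffun G -> 'I_k}) : bool :=
  [forall x : G, forall y : G, adj x y ==> (f x != f y)].

(* Every colour in 'I_k must be used: an empty class would satisfy the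
   domination condition vacuously. *)
Definition all_colors_used (k : nat) (f : {ffun G -> 'I_k}) : bool :=
  [forall c : 'I_k, exists x : G, f x == c].

Definition td_coloring (k : nat) (f : {ffun G -> 'I_k}) : bool :=
  [&& proper_coloring f, all_colors_used f &
      [forall x : G, exists c : 'I_k,
         (c != f x) && [forall y : G, (f y == c) ==> adj x y]]].

Definition td_colorable (k : nat) : bool :=
  [exists f : {ffun G -> 'I_k}, td_coloring f].

(* Without isolated vertices, giving all vertices distinct colours works. *)
Lemma td_colorable_ex : no_isolated -> exists k, td_colorable k.
Proof.
move=> /forallP noiso; exists #|G|; apply/existsP.
exists [ffun x => enum_rank x]; apply/and3P; split.
- apply/forallP=> x; apply/forallP=> y; apply/implyP=> xy.
  rewrite !ffunE (inj_eq enum_rank_inj); apply/eqP=> exy.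
  by move: xy; rewrite exy adj_irr.
- apply/forallP=> c; apply/existsP; exists (enum_val c).
  by rewrite ffunE enum_valK.
apply/forallP=> x; have /existsP[y xy] := noiso x.
apply/existsP; exists (enum_rank y); rewrite ffunE (inj_eq enum_rank_inj).
apply/andP; split.
  by apply/eqP=> eyx; move: xy; rewrite eyx adj_irr.
apply/forallP=> z; rewrite ffunE (inj_eq enum_rank_inj).
by apply/implyP=> /eqP->.
Qed.

Definition td_chromatic (h : no_isolated) : nat := ex_minn (td_colorable_ex h).

End Invariants.

Definition cut_vertex (G : sgraph) (v : G) : bool :=
  num_components G < num_components (del_vertex v).

(* Main.v *)
Require Import Defs.
From mathcomp Require Import all_boot all_order all_algebra.
From mathcomp Require Import zify.

(**
Let H be the corona of the star K_{1,n}: attach a pendant vertex to each of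
its n + 1 vertices.  A class dominated by a pendant vertex can only be the
singleton of its support, so H needs at least n + 1 colours.  H is connected
and bipartite, so adding a vertex v adjacent to all of H gives a graph with a
TD-colouring in 3 colours: every vertex of H dominates {v}, and v dominates
both sides of H.
*)

Set Implicit Arguments.
Unset Strict Implicit.
Unset Printing Implicit Defensive.

Lemma td_chromatic_colorable (G : sgraph) (h : no_isolated G) :
  td_colorable G (td_chromatic h).
Proof. by rewrite /td_chromatic; case: ex_minnP. Qed.

Lemma td_chromatic_min (G : sgraph) (h : no_isolated G) k :
  td_colorable G k -> td_chromatic h <= k.
Proof. by rewrite /td_chromatic; case: ex_minnP => m _; apply. Qed.

(** The only neighbour of [b i] is [a i], so the class that [b i] dominates is contained in the
    singleton of [a i]. The colour of [a i] is then found nowhere else, and distinct supports use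
    distinct colours. *)
Lemma td_colorable_pendant (G : sgraph) (I : finType) (a b : I -> G) k :
    injective a -> (forall i y, adj (b i) y = (y == a i)) ->
  td_colorable G k -> #|I| <= k.
Proof.
move=> a_inj ab /existsP[f /and3P[_ /forallP used /forallP dom]].
have fa i y : f y = f (a i) -> y = a i.
  have /existsP[c /andP[_ /forallP cb]] := dom (b i).
  have cE z : f z = c -> z = a i.
    by move=> /eqP fz; apply/eqP; rewrite -ab; apply: (implyP (cb z)).
  (* The class of [c] is nonempty, hence equal to the singleton of [a i], and [c] is the colour of
     [a i]. *)
  have /existsP[x /eqP fx] := used c.
  by rewrite -{1}(cE x fx) fx; apply: cE.
rewrite -[k]card_ord; apply: (leq_card (fun i => f (a i))) => i j.
by move/fa/a_inj.
Qed.

(** The colour classes are [v] alone and the two sides given by [g]: every other vertex dominates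
    the class of [v], and [v] dominates either side. The last hypothesis makes both sides nonempty,
    so all three colours occur. *)
Lemma td_colorable_universal (G : sgraph) (v : G) (g : G -> bool) :
    (forall x, x != v -> adj x v) ->
    (forall x y, x != v -> y != v -> adj x y -> g x != g y) ->
    (forall s, exists2 x, x != v & g x = s) ->
  td_colorable G 3.
Proof.
move=> univ bip sides; apply/existsP.
pose c0 : 'I_3 := inord 0; pose c1 : 'I_3 := inord 1; pose c2 : 'I_3 := inord 2.
have [c01 c02 c12] : [/\ c0 != c1, c0 != c2 & c1 != c2].
  by split; rewrite -val_eqE /= !inordK.
pose f := [ffun x : G => if x == v then c0 else if g x then c1 else c2].
have fv : f v = c0 by rewrite ffunE eqxx.
have fN x : x != v -> f x != c0.
  by rewrite ffunE => /negPf->; case: ifP; rewrite eq_sym.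
exists f; apply/and3P; split.
- apply/forallP=> x; apply/forallP=> y; apply/implyP=> xy.
  have [xv|xv] := eqVneq x v.
    rewrite xv fv eq_sym; apply: fN; apply: contraTneq xy => ->.
    by rewrite xv adj_irr.
  have [yv|yv] := eqVneq y v; first by rewrite yv fv fN.
  rewrite !ffunE (negPf xv) (negPf yv).
  by have := bip x y xv yv xy; case: (g x); case: (g y); rewrite ?[c2 == _]eq_sym.
- apply/forallP=> c; apply/existsP.
  have [x xv gx] := sides true; have [y yv gy] := sides false.
  have : [|| c == c0, c == c1 | c == c2].
    by rewrite -!val_eqE /= !inordK //; case: c => [[|[|[|]]]].
  case/or3P=> /eqP->; [exists v | exists x | exists y].
  + by rewrite fv.
  + by rewrite ffunE (negPf xv) gx.
  + by rewrite ffunE (negPf yv) gy.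
apply/forallP=> x; apply/existsP; have [->|xv] := eqVneq x v.
  exists c1; rewrite fv eq_sym c01; apply/forallP=> y; apply/implyP=> /eqP fy.
  by rewrite adj_sym univ //; apply: contraNneq c01 => yv; rewrite -fy yv fv.
exists c0; rewrite eq_sym fN //; apply/forallP=> y; apply/implyP=> fy.
by have [->|/fN] := eqVneq y v; [apply: univ | rewrite fy].
Qed.

Lemma num_components_connect (G : sgraph) (r : G) :
  (forall x, connect (@adj G) r x) -> num_components G = 1.
Proof.
move=> conn; have symG : connect_sym (@adj G) := sym_connect_sym (@adj_sym G).
rewrite -(n_comp_connect symG r); apply: eq_n_comp_r => x.
by rewrite [RHS]conn.
Qed.

Section ConedStarCorona.
Variable n : nat.

(* [Some (i, true)] are the vertices of the star, centred at [i = 0],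
   [Some (i, false)] their pendants, and [None] is the apex. *)
Definition cone_adj : rel (option ('I_n.+1 * bool)) := fun x y =>
  match x, y with
  | None, None => false
  | Some (i, p), Some (j, q) =>
      if i == j then p != q else [&& p, q & (i == ord0) || (j == ord0)]
  | _, _ => true
  end.

Fact cone_adj_sym : symmetric cone_adj.
Proof.
move=> [[i p]|] [[j q]|] //=; rewrite [j == i]eq_sym [q == p]eq_sym.
by rewrite andbCA orbC.
Qed.

Fact cone_adj_irr : irreflexive cone_adj.
Proof. by move=> [[i p]|] //=; rewrite !eqxx. Qed.

Definition cone : sgraph := SGraph cone_adj_sym cone_adj_irr.

(** Taken as a deletion, so that it is literally the graph [del_vertex v] of the theorem. *)
Definition corona : sgraph := @del_vertex cone None.

Definition corona_vertex (i : 'I_n.+1) (p : bool) : corona :=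
  exist (fun x : cone => x != None) (Some (i, p)) isT.

Lemma corona_vertexP (x : corona) : exists i p, x = corona_vertex i p.
Proof. by case: x => [[[i p]|] //= ?]; exists i, p; apply: val_inj. Qed.

Lemma adj_pendant i (y : corona) :
  adj (corona_vertex i false) y = (y == corona_vertex i true).
Proof.
have [j [q ->]] := corona_vertexP y; rewrite -val_eqE /= /del_adj /=.
(* Equality under [Some] is convertible to equality of the underlying pairs. *)
rewrite -[RHS]/((j, q) == (i, true)) xpair_eqE [j == i]eq_sym.
by case: eqP; case: q.
Qed.

Lemma adj_support i p : adj (corona_vertex i p) (corona_vertex i (~~ p)).
Proof. by rewrite /= /del_adj /= eqxx; case: p. Qed.

Lemma corona_no_isolated : no_isolated corona.
Proof.
apply/forallP=> x; have [i [p ->]] := corona_vertexP x.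
by apply/existsP; exists (corona_vertex i (~~ p)); apply: adj_support.
Qed.

Lemma cone_no_isolated : no_isolated cone.
Proof.
apply/forallP=> -[[i p]|]; apply/existsP; first by exists None.
by exists (Some (ord0, true)).
Qed.

Lemma corona_connect x : connect (@adj corona) (corona_vertex ord0 true) x.
Proof.
have star i : connect (@adj corona) (corona_vertex ord0 true) (corona_vertex i true).
  have [->//|i0] := eqVneq i ord0.
  by apply: connect1; rewrite /= /del_adj /= eq_sym (negPf i0).
have [i [[] ->]] := corona_vertexP x; first exact: star.
by apply: connect_trans (star i) (connect1 _); apply: adj_support.
Qed.

Lemma cone_connect (x : cone) : connect (@adj cone) None x.
Proof. by case: x => [x|//]; apply: connect1; case: x. Qed.

Lemma cone_connected : connected_graph cone.
Proof.
apply/andP; split; first by apply/card_gt0P; exists None.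
apply/forallP=> x; apply/forallP=> y; apply: connect_trans (cone_connect y).
by rewrite (sym_connect_sym (@adj_sym cone)) cone_connect.
Qed.

Lemma cone_td_colorable : td_colorable cone 3.
Proof.
(* On the corona, [g] is the parity of the distance to the centre of the star: true on the leaves of
   the star and on the pendant of the centre. *)
pose g (x : cone) := if x is Some (i, p) then (i == ord0) (+) p else false.
apply: (@td_colorable_universal cone None g).
- by case=> [[]|].
- move=> [[i p]|] [[j q]|] //= _ _; case: eqVneq => [->|ij].
    by case: (j == _) p q => -[] [].
  case/and3P=> -> ->; case: (eqVneq i ord0) ij => [->|_ _] /=.
    by rewrite eq_sym => /negPf->.
  by move=> ->.
(* The centre and its own pendant represent the two sides. *)
by move=> s; exists (Some (ord0, ~~ s)); rewrite //= negbK.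
Qed.

Lemma corona_td_colorable k : td_colorable corona k -> n < k.
Proof.
rewrite -[n.+1]card_ord; apply: td_colorable_pendant adj_pendant.
by move=> i j [].
Qed.

End ConedStarCorona.

Theorem theorem2p5 (M : nat) (M_gt0 : 0 < M) :
  exists (G : sgraph) (v : G)
         (hG : no_isolated G) (hGv : no_isolated (del_vertex v)),
    [/\ connected_graph G,
        ~~ cut_vertex v
      & (M%:Z <= `|(td_chromatic hG)%:Z - (td_chromatic hGv)%:Z|)%R].
Proof.
(* With [n = M + 2] the corona needs at least [M + 3] colours and the cone at most 3, a gap of at
   least [M]. *)
exists (cone (M + 2)), None, (cone_no_isolated _), (corona_no_isolated _).
split; first exact: cone_connected.
  rewrite /cut_vertex (num_components_connect (@cone_connect _)).
  by rewrite (num_components_connect (@corona_connect _)).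
have := td_chromatic_min (cone_no_isolated (M + 2)) (cone_td_colorable _).
have := corona_td_colorable (td_chromatic_colorable (corona_no_isolated (M + 2))).
rewrite /corona; lia.
Qed.
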